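(* For every $f\in\mathbb Z[\mathbf t][\mathbf x]$, $$f(\mathbf x;\mathbf t)=\sum_{F}a_F\,\mathfrak P_F(\mathbf x;\mathbf t)\quad\text{(finite sum over indexed forests)},$$ where for each indexed forest $F$ and each factorization $F=\underline{i_1}\cdot\underline{i_2}\cdots\underline{i_k}$ into elementary forests, $$a_F=\mathrm{ev}_{A_0}\,E_{i_1,A_1}E_{i_2,A_2}\cdots E_{i_k,A_k}\,f,\qquad A_j=i_{j+1}\star i_{j+2}\star\cdots\star i_k\ (0\le j\le k),$$ with $A_k=\emptyset$ (for $F=\emptyset$, $a_\emptyset=f(\mathbf t;\mathbf t)$).
   Context: $\mathbf x=(x_1,x_2,\dots)$, $\mathbf t=(t_1,t_2,\dots)$. For a finite $A\subset\mathbb N$ let $\overline A_1<\overline A_2<\cdots$ enumerate $\mathbb N\setminus A$ and $t_{i,A}=t_{\overline A_i}$. Define $\mathrm{ev}_Af=f(t_{1,A},t_{2,A},\dots;\mathbf t)$, $R^-_{i,A}f=f(x_1,\dots,x_{i-1},t_{i,A},x_i,x_{i+1},\dots;\mathbf t)$, $R^+_{i,A}f=f(x_1,\dots,x_i,t_{i,A},x_{i+1},\dots;\mathbf t)$, $E_{i,A}f=(R^+_{i,A}f-R^-_{i,A}f)/(x_i-t_{i,A})$. For finite $A,B\subset\mathbb N$, $A\star B=\{\overline B_i:i\in A\}\cup B$; an integer $i$ is identified with $\{i\}$, and $i_{j+1}\star\cdots\star i_k$ is computed right-nested: $i_{j+1}\star(i_{j+2}\star(\cdots\star\{i_k\}))$.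 Indexed forests: sequences $F=(T_1,T_2,\dots)$ of binary plane trees (each node a leaf or an internal node with ordered left/right children), all but finitely many one-node trees; leaves identified with $\mathbb N$ left to right; $\emptyset$ has no internal nodes. $\rho_F(v)$: leaf reached from internal node $v$ going repeatedly to left children; terminal: both children leaves; $\mathrm{Qdes}(F)=\{\rho_F(v):v\text{ terminal}\}$; $F/i$ deletes the terminal node with $\rho_F(v)=i$ (replacing it and its leaves by one leaf, relabeling). Product: $F\cdot G$ is obtained by grafting, for each $i\in\mathbb N$, the $i$-th tree of $G$ onto the $i$-th leaf of $F$ (identifying that leaf with the root of that tree). The elementary forest $\underline i$ has a single internal node, whose children are the leaves $i$ and $i+1$. Every forest with $k$ internal nodes is a product of $k$ elementary forests. Double forest polynomials: with $R_i^\pm=R^\pm_{i,\emptyset}$, $E_i=E_{i,\emptyset}$, $\mathfrak P_F$ is the unique homogeneous family ($\deg x_i=\deg t_i=1$) with $\mathfrak P_F(\mathbf t;\mathbf t)=\delta_{F,\emptyset}$ and $E_i\mathfrak P_F=\mathfrak P_{F/i}(\mathbf x;\widehat{\mathbf t}_i)$ if $i\in\mathrm{Qdes}(F)$, else $0$, where $\widehat{\mathbf t}_i=(t_1,\dots,t_{i-1},t_{i+1},\dots)$. *)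

(* Defs.v *)
From HB Require Import structures.
From mathcomp Require Import all_boot all_order all_algebra.
From mathcomp Require Import finmap.
From mathcomp.multinomials Require Import monalg.
From Stdlib Require Import ClassicalEpsilon.

Set Implicit Arguments.
Unset Strict Implicit.
Unset Printing Implicit Defensive.

Import GRing.Theory.
Local Open Scope ring_scope.

(* Polynomials Z[t][x] = Z[x_1, x_2, ..., t_1, t_2, ...].             *)
(* The variable [inl k] is x_(k+1) and [inr k] is t_(k+1).             *)
Definition var := (nat + nat)%type.
Definition dpoly := {malg int[{cmonom var}]}.

(* x_j and t_j for j >= 1 (1-based, as in the paper) *)
Definition xv (j : nat) : dpoly := << ucm (inl j.-1 : var) >>.
Definition tv (j : nat) : dpoly := << ucm (inr j.-1 : var) >>.

Definition varimg (sx st : nat -> dpoly) (v : var) : dpoly :=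
  match v with inl k => sx k.+1 | inr k => st k.+1 end.

Definition subst (sx st : nat -> dpoly) (f : dpoly) : dpoly :=
  mmap (fun c : int => c%:~R)
       (fun m : {cmonom var} =>
          \prod_(v <- finsupp m) varimg sx st v ^+ m v) f.

Definition homogeneous (f : dpoly) : Prop :=
  exists d : nat, forall m, m \in msupp f -> mdeg m = d.

(* Finite subsets of N = {1,2,...}, represented by sequences (only     *)
(* membership matters).                                                *)
(* compl_nth A i = \overline{A}_i : the i-th (i >= 1) element of N \ A *)
Definition compl_nth (A : seq nat) (i : nat) : nat :=
  nth 0%N [seq m <- iota 1 (i + size A) | m \notin A] i.-1.

Definition star (A B : seq nat) : seq nat := [seq compl_nth B i | i <- A] ++ B.

Fixpoint starw (s : seq nat) : seq nat :=
  match s with [::] => [::] | i :: s' => star [:: i] (starw s') end.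

Definition tA (i : nat) (A : seq nat) : dpoly := tv (compl_nth A i).

Definition evA (A : seq nat) (f : dpoly) : dpoly := subst (fun j => tA j A) tv f.

Definition Rminus (i : nat) (A : seq nat) (f : dpoly) : dpoly :=
  subst (fun j => if (j < i)%N then xv j else if j == i then tA i A
                  else xv j.-1) tv f.

Definition Rplus (i : nat) (A : seq nat) (f : dpoly) : dpoly :=
  subst (fun j => if (j <= i)%N then xv j else if j == i.+1 then tA i A
                  else xv j.-1) tv f.

(* E_{i,A} f = (R^+_{i,A} f - R^-_{i,A} f) / (x_i - t_{i,A}) : the (exact)
   quotient, i.e. the polynomial g with (x_i - t_{i,A}) g = R^+ f - R^- f. *)
Definition EA (i : nat) (A : seq nat) (f : dpoly) : dpoly :=
  epsilon (inhabits 0)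
    (fun g : dpoly => (xv i - tA i A) * g = Rplus i A f - Rminus i A f).

Definition that (i : nat) (f : dpoly) : dpoly :=
  subst xv (fun j => if (j < i)%N then tv j else tv j.+1) f.

Inductive tree := Leaf | Node of tree & tree.

Fixpoint eqtree (a b : tree) : bool :=
  match a, b with
  | Leaf, Leaf => true
  | Node l r, Node l' r' => eqtree l l' && eqtree r r'
  | _, _ => false
  end.

Lemma eqtreeP : Equality.axiom eqtree.
Proof.
elim=> [|l IHl r IHr] [|l' r'] /=; try by constructor.
case: (IHl l') => [<-|Hl]; last by constructor; case.
case: (IHr r') => [<-|Hr]; last by constructor; case.
by constructor.
Qed.

HB.instance Definition _ := hasDecEq.Build tree eqtreeP.

Fixpoint strip (s : seq tree) : seq tree :=
  match s with
  | [::] => [::]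
  | a :: s' => let s'' := strip s' in
               if (s'' == [::]) && (a == Leaf) then [::] else a :: s''
  end.

Lemma strip_idem s : strip (strip s) == strip s.
Proof.
apply/eqP; elim: s => [|a s IH] //=.
case: ifP => // H /=; rewrite IH H //.
Qed.

(* An indexed forest (T_1, T_2, ...) is represented by the finite list of
   its trees up to the last one with an internal node. *)
Definition forest := {s : seq tree | strip s == s}.

Definition mkF (s : seq tree) : forest := exist _ (strip s) (strip_idem s).

Definition emptyF : forest := mkF [::].

Fixpoint nleaves (a : tree) : nat :=
  match a with Leaf => 1%N | Node l r => (nleaves l + nleaves r)%N end.

Definition terminal (a : tree) : bool := a == Node Leaf Leaf.

Fixpoint graft (a : tree) (gs : seq tree) : tree * seq tree :=
  match a with
  | Leaf => (head Leaf gs, behead gs)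
  | Node l r => let (l', gs1) := graft l gs in
                let (r', gs2) := graft r gs1 in (Node l' r', gs2)
  end.

Fixpoint graftF (fs gs : seq tree) : seq tree :=
  match fs with
  | [::] => gs
  | a :: fs' => let (a', gs') := graft a gs in a' :: graftF fs' gs'
  end.

Definition mulF (F G : forest) : forest := mkF (graftF (val F) (val G)).

Definition elemF (i : nat) : forest :=
  mkF (rcons (nseq i.-1 Leaf) (Node Leaf Leaf)).

Definition wordF (s : seq nat) : forest :=
  foldr (fun i F => mulF (elemF i) F) emptyF s.

(* leaves are numbered 1,2,... left to right; o = label of the leftmost
   leaf of the current subtree, which is rho_F of its root *)
Fixpoint qdes_tree (a : tree) (o : nat) : seq nat :=
  match a with
  | Leaf => [::]
  | Node l r => if terminal a then [:: o]
                else qdes_tree l o ++ qdes_tree r (o + nleaves l)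
  end.

Fixpoint qdes_seq (fs : seq tree) (o : nat) : seq nat :=
  match fs with
  | [::] => [::]
  | a :: fs' => qdes_tree a o ++ qdes_seq fs' (o + nleaves a)
  end.

Definition Qdes (F : forest) : seq nat := qdes_seq (val F) 1.

Fixpoint del_tree (a : tree) (o i : nat) : tree :=
  match a with
  | Leaf => Leaf
  | Node l r => if terminal a && (o == i) then Leaf
                else Node (del_tree l o i) (del_tree r (o + nleaves l) i)
  end.

Fixpoint del_seq (fs : seq tree) (o i : nat) : seq tree :=
  match fs with
  | [::] => [::]
  | a :: fs' => del_tree a o i :: del_seq fs' (o + nleaves a) i
  end.

Definition delF (F : forest) (i : nat) : forest := mkF (del_seq (val F) 1 i).

Definition is_double_forest_family (P : forest -> dpoly) : Prop :=
  [/\ forall F, homogeneous (P F),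
      forall F, evA [::] (P F) = (F == emptyF)%:R
    & forall F (i : nat), (0 < i)%N ->
        EA i [::] (P F) = if i \in Qdes F then that i (P (delF F i)) else 0].

Fixpoint applyE (s : seq nat) (f : dpoly) : dpoly :=
  match s with
  | [::] => f
  | i :: s' => EA i (starw s') (applyE s' f)
  end.

Definition coef_word (s : seq nat) (f : dpoly) : dpoly :=
  evA (starw s) (applyE s f).

(* Main.v *)
(* The coefficient functionals attached to the words i_1 ... i_k are
   Z[t]-linear, and four facts about them give the expansion.
   - Duality: applied to P_F, the functional of a word is 1 if the word
     factors F and 0 otherwise. E_i lowers P_F to P_{F/i} in the variables
     t without t_i, and the subscripts A_j are exactly what absorbs this
     renaming; moreover G.i = F iff i is in Qdes F and G = F/i.
   - Injectivity: a polynomial killed by all functionals is 0. By induction on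
     the x-degree every E_i f vanishes; if f involves only x_1, ..., x_n, then
     E_n f = 0 says that f does not depend on x_n, and so on down to f = f(t;t),
     which is the functional of the empty word.
   - Finiteness: E_i f = 0 when f involves only x_1, ..., x_n and n < i, and
     each E_i lowers the x-degree.
   - Independence of the factorization: for i < k the operators satisfy the
     relation k.i = i.(k+1) of the forest monoid, so every word can be sorted
     into a weakly increasing one, and a forest has only one weakly increasing
     factorization because its last letter is the maximum of Qdes.
   Hence f minus its candidate expansion is killed by all functionals. *)

Require Import Defs.
From HB Require Import structures.
From mathcomp Require Import all_boot all_order all_algebra.
From mathcomp Require Import finmap zify ring.
From mathcomp.multinomials Require Import monalg.
From Stdlib Require Import ClassicalEpsilon.

Set Implicit Arguments.
Unset Strict Implicit.
Unset Printing Implicit Defensive.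

Import GRing.Theory.
Local Open Scope ring_scope.

Local Notation posw := (all (leq 1)).

(** * Complements of finite sets *)

(* The increasing enumeration of N \ {i}; both i and j start at 1. *)
Definition skip i j := if (j < i)%N then j else j.+1.

(** At most [size A] integers of the window are removed, so [i] survive, and a longer window only
    appends larger ones. Complements of different sets can thus be compared in one window. *)
Lemma compl_nthE A i n : (0 < i)%N -> (i + size A <= n)%N ->
  compl_nth A i = nth 0%N [seq m <- iota 1 n | m \notin A] i.-1 /\
  (i.-1 < size [seq m <- iota 1 n | m \notin A])%N.
Proof.
move=> i0 le_n; have lt_i N : (i + size A <= N)%N ->
    (i.-1 < size [seq m <- iota 1 N | m \notin A])%N.
  move=> le_N; have /eqP := count_predC (mem A) (iota 1 N).
  have leA : (count (mem A) (iota 1 N) <= size A)%N.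
    rewrite -size_filter; apply: uniq_leq_size => [|m].
      by rewrite filter_uniq ?iota_uniq.
    by rewrite mem_filter => /andP[].
  rewrite size_iota size_filter; set c := count (mem A) _ in leA *.
  by rewrite -[count (fun _ => _) _]/(count (predC (mem A)) _); lia.
split; last exact: lt_i.
rewrite -(subnKC le_n) (iotaD 1 (i + size A)) filter_cat nth_cat.
by rewrite (lt_i _ (leqnn _)).
Qed.

Lemma compl_nth_nil j : (0 < j)%N -> compl_nth [::] j = j.
Proof.
move=> j0; rewrite /compl_nth /= addn0 (eq_filter (a2 := predT)) // filter_predT.
by rewrite nth_iota ?prednK // add1n prednK.
Qed.

Lemma compl_nth_star1 i j A : (0 < i)%N -> (0 < j)%N ->
  compl_nth (star [:: i] A) j = compl_nth A (skip i j).
Proof.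
move=> i0 j0; pose N := (i + j + size A).+1.
have sk0 : (0 < skip i j)%N by rewrite /skip; case: ifP.
have leN1 : (i + size A <= N)%N by rewrite /N; lia.
have leN2 : (skip i j + size A <= N)%N by rewrite /N /skip; case: ifP; lia.
have leN3 : (j + size (star [:: i] A) <= N)%N by rewrite /N /=; lia.
have [def_i lt_i] := compl_nthE i0 leN1.
have [-> lt_sk] := compl_nthE sk0 leN2.
have [-> _] := compl_nthE j0 leN3.
set L := filter _ (iota 1 N) in def_i lt_i lt_sk *.
have uniqL : uniq L by rewrite filter_uniq ?iota_uniq.
(* [L] has no repetition, so one more excluded element removes the single entry at position [i.-1];
   later positions move by one, which is [skip i]. *)
have -> : [seq m <- iota 1 N | m \notin star [:: i] A] = rem (compl_nth A i) L.
  rewrite rem_filter // -filter_predI; apply: eq_filter => m /=.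
  by rewrite inE negb_or.
rewrite def_i remE index_uniq // nth_cat size_take lt_i nth_drop /skip.
case: (ltnP j i) => ltji.
  by rewrite ifT ?nth_take //; lia.
by rewrite ifF; [congr nth; lia | lia].
Qed.

(** * The monoid of indexed forests *)

Lemma nth_strip s n : nth Leaf (strip s) n = nth Leaf s n.
Proof.
elim: s n => [//|a s IH] n /=; case: ifP => [/andP[/eqP s0 /eqP ->]|_].
  by case: n => [//|n]; rewrite /= -IH s0 nth_nil.
by case: n => [//|n] /=.
Qed.

Lemma strip_nil s : (forall n, nth Leaf s n = Leaf) -> strip s = [::].
Proof.
elim: s => [//|a s IH] nth0 /=; rewrite IH => [|n]; last exact: (nth0 n.+1).
by rewrite [a](nth0 0%N).
Qed.

Lemma eq_strip s s' : nth Leaf s =1 nth Leaf s' -> strip s = strip s'.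
Proof.
elim: s s' => [|a s IH] [|a' s'] eqs //.
- by rewrite [RHS]strip_nil // => n; rewrite -eqs nth_nil.
- by rewrite [LHS]strip_nil // => n; rewrite eqs nth_nil.
by rewrite /= (IH s') => [|n]; [rewrite [a](eqs 0%N) | apply: (eqs n.+1)].
Qed.

Lemma nth_mkF s : nth Leaf (val (mkF s)) =1 nth Leaf s.
Proof. by move=> n; rewrite nth_strip. Qed.

Lemma forestP (F G : forest) :
  nth Leaf (val F) =1 nth Leaf (val G) -> F = G.
Proof.
move=> eqFG; apply: val_inj; rewrite -(eqP (valP F)) -(eqP (valP G)).
exact: eq_strip.
Qed.

(* A forest is handled as the function n |-> T_(n+1); leaves are numbered from
   0, and [offset F n] is the number of the leftmost leaf of [F n]. *)
Fixpoint offset (F : nat -> tree) n : nat :=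
  if n is n'.+1 then (offset F n' + nleaves (F n'))%N else 0%N.

Lemma offsetS F n : offset F n.+1 = (offset F n + nleaves (F n))%N.
Proof. by []. Qed.

(** Grafts [g o], [g o.+1], ... onto the leaves of [a], where [o] is the number of its leftmost
    leaf. Passing a position instead of a shrinking list makes associativity an identity of
    functions. *)
Fixpoint plant (a : tree) (g : nat -> tree) (o : nat) : tree :=
  if a is Node l r then Node (plant l g o) (plant r g (o + nleaves l)) else g o.

Definition fmul (F G : nat -> tree) n := plant (F n) G (offset F n).

Lemma nleaves_gt0 a : (0 < nleaves a)%N.
Proof. by elim: a => //= l IHl r IHr; rewrite addn_gt0 IHl. Qed.

Lemma eq_offset F G : F =1 G -> offset F =1 offset G.
Proof. by move=> eqFG; elim=> //= n ->; rewrite eqFG. Qed.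

Lemma leq_offset F m n : (m <= n)%N -> (offset F m <= offset F n)%N.
Proof.
move=> /subnKC <-; elim: (n - m)%N => [|p IH]; first by rewrite addn0.
by rewrite addnS /=; apply: leq_trans IH (leq_addr _ _).
Qed.

Lemma offset_locate F m : exists n, (offset F n <= m < offset F n.+1)%N.
Proof.
elim: m => [|m [n /andP[le_m lt_m]]]; first by exists 0%N; rewrite /= nleaves_gt0.
have [eq_m|neq] := eqVneq m.+1 (offset F n.+1).
  exists n.+1; rewrite [offset F n.+2]offsetS -eq_m leqnn.
  by rewrite -[X in (X < _)%N]addn0 ltn_add2l nleaves_gt0.
by exists n; rewrite (leqW le_m) ltn_neqAle neq.
Qed.

Lemma eq_plant a g h : g =1 h -> plant a g =1 plant a h.
Proof. by move=> eqgh; elim: a => //= l IHl r IHr o; rewrite IHl IHr. Qed.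

Lemma plant_shift a g p o : plant a (fun k => g (p + k)%N) o = plant a g (p + o).
Proof. by elim: a o => //= l IHl r IHr o; rewrite IHl IHr addnA. Qed.

Lemma graftE a gs :
  graft a gs = (plant a (nth Leaf gs) 0, drop (nleaves a) gs).
Proof.
elim: a gs => [|l IHl r IHr] gs /=; first by rewrite nth0 drop1.
rewrite IHl IHr drop_drop addnC; congr (Node _ _, _).
rewrite add0n -{2}(addn0 (nleaves l)) -plant_shift.
by apply: eq_plant => k; rewrite nth_drop.
Qed.

Lemma offset_cons a fs n :
  offset (nth Leaf (a :: fs)) n.+1 = (nleaves a + offset (nth Leaf fs) n)%N.
Proof.
elim: n => [|n IH]; first by rewrite /= addn0 add0n.
by rewrite offsetS IH /= addnA.
Qed.

Lemma offset_leaves n : offset (nth Leaf [::]) n = n.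
Proof. by elim: n => //= n ->; rewrite nth_nil addn1. Qed.

Lemma nth_graftF fs gs :
  nth Leaf (graftF fs gs) =1 fmul (nth Leaf fs) (nth Leaf gs).
Proof.
elim: fs gs => [|a fs IH] gs n; first by rewrite /fmul nth_nil /= offset_leaves.
rewrite /= graftE; case: n => [//|n].
rewrite /= IH /fmul offset_cons -plant_shift.
by apply: eq_plant => k; rewrite nth_drop.
Qed.

Lemma nth_mulF F G :
  nth Leaf (val (mulF F G)) =1 fmul (nth Leaf (val F)) (nth Leaf (val G)).
Proof. by move=> n; rewrite nth_mkF nth_graftF. Qed.

Lemma offset_plant g a o :
  offset g (o + nleaves a) = (offset g o + nleaves (plant a g o))%N.
Proof.
elim: a o => [|l IHl r IHr] o /=; first by rewrite addn1.
by rewrite addnA IHr IHl addnA.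
Qed.

Lemma offset_fmul F G n : offset (fmul F G) n = offset G (offset F n).
Proof. by elim: n => //= n ->; rewrite offset_plant. Qed.

Lemma plant_plant a g h o :
  plant (plant a g o) h (offset g o) = plant a (fmul g h) o.
Proof. by elim: a o => [//|l IHl r IHr] o /=; rewrite -offset_plant IHl IHr. Qed.

Lemma fmulA F G H : fmul (fmul F G) H =1 fmul F (fmul G H).
Proof. by move=> n; rewrite {1}/fmul offset_fmul plant_plant. Qed.

Lemma eq_fmul F F' G G' : F =1 F' -> G =1 G' -> fmul F G =1 fmul F' G'.
Proof. by move=> eqF eqG n; rewrite /fmul eqF (eq_offset eqF) (eq_plant _ eqG). Qed.

Lemma mulFA F G H : mulF (mulF F G) H = mulF F (mulF G H).
Proof.
apply: forestP => n; rewrite !nth_mulF (eq_fmul (nth_mulF F G) (frefl _)) fmulA.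
by apply: eq_fmul => // m; rewrite nth_mulF.
Qed.

Lemma nth_emptyF n : nth Leaf (val emptyF) n = Leaf.
Proof. by rewrite nth_nil. Qed.

Lemma mul0F G : mulF emptyF G = G.
Proof.
apply: forestP => n; rewrite nth_mulF /fmul nth_emptyF /=.
by rewrite offset_leaves.
Qed.

Lemma mulF0 F : mulF F emptyF = F.
Proof.
apply: forestP => n; rewrite nth_mulF /fmul; move: (offset _ _).
by elim: (nth _ _ _) => [|l IHl r IHr] o /=; rewrite ?nth_nil // IHl IHr.
Qed.

(* [revF [:: i_k; ...; i_1]] is the forest of the word i_1 ... i_k. *)
Definition revF (r : seq nat) : forest :=
  foldr (fun i F => mulF F (elemF i)) emptyF r.

Lemma mul_revF r s : mulF (revF r) (wordF s) = wordF (catrev r s).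
Proof. by elim: r s => [|i r IH] s /=; rewrite ?mul0F // mulFA -IH. Qed.

Lemma wordF_rev s : wordF s = revF (rev s).
Proof. by rewrite -[RHS]mulF0 -[emptyF]/(wordF [::]) mul_revF -/(rev _) revK. Qed.

(** * Elementary forests and deletion of terminal nodes *)

Definition cherry i k := if k.+1 == i then Node Leaf Leaf else Leaf.

Lemma nth_elemF i : (0 < i)%N -> nth Leaf (val (elemF i)) =1 cherry i.
Proof.
case: i => // i _ n; rewrite nth_mkF nth_rcons size_nseq nth_nseq /cherry eqSS.
by case: ltngtP.
Qed.

Lemma offset_cherry i n : (0 < i)%N -> offset (cherry i) n = (n + (i <= n))%N.
Proof.
move=> i0; elim: n => [|n IH]; first by rewrite leqNgt i0.
by rewrite /= IH /cherry; case: (ltngtP n.+1 i) => ? /=; lia.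
Qed.

Lemma plant_leaf a i o : plant a (cherry i) o = Leaf -> a = Leaf /\ o.+1 != i.
Proof. by case: a => //=; rewrite /cherry; case: eqP. Qed.

Lemma del_plant a i o : (0 < i)%N ->
  del_tree (plant a (cherry i) o) (offset (cherry i) o).+1 i = a.
Proof.
move=> i0; elim: a o => [|l IHl r IHr] o /=.
  by rewrite offset_cherry // /cherry; case: eqP => //= neq; rewrite ifT //; lia.
(* An internal node of [a] is not deleted: if terminal after grafting, its left child is a leaf that
   received no cherry, hence not leaf [i]. *)
rewrite ifF; last first.
  apply/negP => /andP[/eqP[/plant_leaf[_ neq] _] /eqP].
  by rewrite offset_cherry //; lia.
by rewrite IHl addSn -offset_plant IHr.
Qed.

Lemma qdes_plant a i o : (0 < i)%N -> (o < i <= o + nleaves a)%N ->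
  i \in qdes_tree (plant a (cherry i) o) (offset (cherry i) o).+1.
Proof.
move=> i0; elim: a o => [|l IHl r IHr] o /= /andP[lt_o le_i].
  have -> : cherry i o = Node Leaf Leaf by rewrite /cherry ifT //; lia.
  by rewrite /= inE offset_cherry //; lia.
rewrite ifF; last first.
  apply/negP => /eqP[/plant_leaf[l0 neq] /plant_leaf[r0 neq']].
  by move: neq' le_i; rewrite l0 r0 /=; lia.
rewrite mem_cat addSn -offset_plant; apply/orP.
by have [?|?] := leqP i (o + nleaves l); [left; apply: IHl | right; apply: IHr]; lia.
Qed.

(** The grafted cherry occupies the leaves [i] and [i.+1], so a terminal node starting at [j > i]
    starts beyond [i.+1]. It comes from a terminal node of [a] whose label is one less. *)
Lemma qdes_plant_gt a i o j : (0 < i < j)%N ->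
    j \in qdes_tree (plant a (cherry i) o) (offset (cherry i) o).+1 ->
  j.-1 \in qdes_tree a o.+1 /\ (i < j.-1)%N.
Proof.
move=> /andP[i0 ltij]; elim: a o => [|l IHl r IHr] o /=.
  rewrite /cherry; case: eqP => //= def_i; rewrite inE offset_cherry //; lia.
case: ifP => [/eqP[/plant_leaf[-> neq] /plant_leaf[-> neq']]|_].
  by rewrite /= !inE offset_cherry //; lia.
rewrite mem_cat addSn -offset_plant => /orP[/IHl|/IHr] [in_a ltij'];
  split=> //; case: ifP => [/eqP[l0 r0]|_]; rewrite ?mem_cat ?addSn ?in_a ?orbT //;
  by move: in_a; rewrite ?l0 ?r0.
Qed.

Lemma qdes_range a p i :
  i \in qdes_tree a p -> (p <= i /\ i.+1 < p + nleaves a)%N.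
Proof.
elim: a p => [//|l IHl r IHr] p /=; case: ifP => [/eqP[-> ->]|_].
  by rewrite inE => /eqP -> /=; lia.
rewrite mem_cat => /orP[/IHl|/IHr]; lia.
Qed.

Lemma del_out a p i : (i < p \/ p + nleaves a <= i)%N -> del_tree a p i = a.
Proof.
elim: a p => [//|l IHl r IHr] p /= out; have := nleaves_gt0 l; have := nleaves_gt0 r.
move=> r0 l0; rewrite ifF; first by rewrite IHl ?IHr //; lia.
by apply/negP => /andP[_ /eqP]; lia.
Qed.

Lemma plant_out a o i :
  (i <= o \/ o + nleaves a < i)%N -> plant a (cherry i) o = a.
Proof.
elim: a o => [|l IHl r IHr] o /= out; first by rewrite /cherry ifF //; lia.
by have := nleaves_gt0 l; have := nleaves_gt0 r => r0 l0; rewrite IHl ?IHr //; lia.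
Qed.

(** Converse of [del_plant]: the node lies in one of the two subtrees, and the other is out of range
    for both deletion and grafting. The leaf count serves to compute later offsets. *)
Lemma plant_del a o i : i \in qdes_tree a o.+1 ->
  (nleaves (del_tree a o.+1 i)).+1 = nleaves a /\
  plant (del_tree a o.+1 i) (cherry i) o = a.
Proof.
elim: a o => [//|l IHl r IHr] o /=; case: ifP => [/eqP[-> ->]|_].
  by rewrite inE => /eqP -> /=; rewrite eqxx /= /cherry eqxx.
rewrite mem_cat addSn /= => /orP[] in_a.
  have [nl pl] := IHl _ in_a; have [_ ?] := qdes_range in_a.
  rewrite (@del_out r); last by lia.
  by rewrite pl (@plant_out r); [split=> //=; lia | lia].
have [nl pl] := IHr _ in_a; have [? _] := qdes_range in_a.
rewrite (@del_out l); last by lia.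
by rewrite pl (@plant_out l); [split=> //=; lia | lia].
Qed.

Lemma mem_qdes_seq fs p j : reflect
  (exists n, j \in qdes_tree (nth Leaf fs n) (p + offset (nth Leaf fs) n))
  (j \in qdes_seq fs p).
Proof.
elim: fs p => [|a fs IH] p /=.
  by apply: (iffP idP) => // -[n]; rewrite nth_nil.
rewrite mem_cat; apply: (iffP orP) => [[in_a|/IH[n in_n]]|[[|n] in_n]].
- by exists 0%N; rewrite /= addn0.
- by exists n.+1; rewrite offset_cons addnA.
- by left; rewrite /= addn0 in in_n.
- by right; apply/IH; exists n; rewrite offset_cons addnA in in_n.
Qed.

Lemma nth_del_seq fs p i n :
  nth Leaf (del_seq fs p i) n =
  del_tree (nth Leaf fs n) (p + offset (nth Leaf fs) n) i.
Proof.
elim: fs p n => [|a fs IH] p n; first by rewrite /= !nth_nil.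
by case: n => [|n]; [rewrite /= addn0 | rewrite offset_cons addnA -IH].
Qed.

Lemma fmul_cherry F G i : (0 < i)%N -> mulF G (elemF i) = F ->
  nth Leaf (val F) =1 fmul (nth Leaf (val G)) (cherry i).
Proof.
move=> i0 <- n; rewrite nth_mulF.
by rewrite (eq_fmul (frefl _) (nth_elemF i0)).
Qed.

Lemma delF_mulF F G i : (0 < i)%N -> mulF G (elemF i) = F ->
  i \in Qdes F /\ delF F i = G.
Proof.
move=> i0 defF; have eqF := fmul_cherry i0 defF; split.
  have [n /andP[le_i lt_i]] := offset_locate (nth Leaf (val G)) i.-1.
  apply/mem_qdes_seq; exists n; rewrite eqF (eq_offset eqF) offset_fmul add1n.
  by apply: qdes_plant => //; rewrite offsetS in lt_i; lia.
apply: forestP => n; rewrite nth_mkF nth_del_seq eqF (eq_offset eqF) offset_fmul.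
by rewrite add1n del_plant.
Qed.

Lemma mulF_delF F i : i \in Qdes F -> mulF (delF F i) (elemF i) = F.
Proof.
move=> in_F; have [n0 in_n0] := mem_qdes_seq _ _ _ in_F.
move: in_n0; set f := nth Leaf (val F); rewrite add1n => in_n0.
have [lt_i le_i] := qdes_range in_n0; have i0 : (0 < i)%N by lia.
pose g n := del_tree (f n) (offset f n).+1 i.
have eqG : nth Leaf (val (delF F i)) =1 g.
  by move=> n; rewrite nth_mkF nth_del_seq add1n.
have [nl pl] := plant_del in_n0.
have low n : (n < n0)%N -> g n = f n.
  by move=> /(leq_offset f) /= le_n; apply: del_out; right; rewrite addSn; lia.
have high n : (n0 < n)%N -> g n = f n.
  by move=> /(leq_offset f) /= le_n; apply: del_out; left; lia.
(* Only the tree [n0] loses a leaf, so offsets agree up to [n0] and drop by one afterwards; hence no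
   other tree contains leaf [i]. *)
have off_low n : (n <= n0)%N -> offset g n = offset f n.
  by elim: n => //= n IH lt_n; rewrite IH ?low // ltnW.
have off_high n : (n0 < n)%N -> (offset g n).+1 = offset f n.
  elim: n => // n IH; rewrite ltnS leq_eqVlt => /orP[/eqP <-|lt_n] /=.
    by rewrite off_low // -nl addnS.
  by rewrite -addSn IH // high.
apply: forestP => n; rewrite nth_mulF (eq_fmul eqG (nth_elemF i0)) /fmul -/f.
case: (ltngtP n n0) => [lt_n|lt_n|->].
- rewrite low // (off_low n (ltnW lt_n)) plant_out //; right.
  by have := leq_offset f lt_n; rewrite offsetS; clear -lt_i; lia.
- rewrite high // plant_out //; left; have := off_high n lt_n.
  by have := leq_offset f lt_n; rewrite offsetS; clear -le_i; lia.
- by rewrite off_low.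
Qed.

Lemma mulF_elemF_eq F G i : (0 < i)%N ->
  (mulF G (elemF i) == F) = (i \in Qdes F) && (G == delF F i).
Proof.
move=> i0; apply/eqP/andP => [/(delF_mulF i0)[in_F <-] //|[in_F /eqP ->]].
exact: mulF_delF.
Qed.

(** By [qdes_plant_gt], an element [j > i] would give [j.-1 > i] in [Qdes] of the forest without the
    last letter, whose elements are at most its own last letter [k <= i]. *)
Lemma Qdes_revF i r j : posw (i :: r) -> pairwise geq (i :: r) ->
  j \in Qdes (revF (i :: r)) -> (j <= i)%N.
Proof.
elim: r i j => [|k r IH] i j /andP[i0 r0].
  move=> _ /mem_qdes_seq[n]; have eqF := fmul_cherry i0 (erefl (revF [:: i])).
  rewrite eqF (eq_offset eqF) offset_fmul add1n => in_n; rewrite leqNgt.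
  apply/negP => ltij; have [] := qdes_plant_gt (introT andP (conj i0 ltij)) in_n.
  by rewrite nth_nil.
move=> /= /andP[/andP[leki _] pw] /mem_qdes_seq[n].
have eqF := fmul_cherry i0 (erefl (revF [:: i, k & r])).
rewrite eqF (eq_offset eqF) offset_fmul add1n => in_n; rewrite leqNgt.
apply/negP => ltij.
have [in_k lt_i] := qdes_plant_gt (introT andP (conj i0 ltij)) in_n.
have : (j.-1 <= k)%N.
  by apply: IH => //; apply/mem_qdes_seq; exists n; rewrite add1n.
by lia.
Qed.

Lemma revF_inj r r' : posw r -> posw r' -> pairwise geq r -> pairwise geq r' ->
  revF r = revF r' -> r = r'.
Proof.
have Qdes0 i l : (0 < i)%N -> revF (i :: l) <> emptyF.
  by move=> i0 /(delF_mulF i0)[].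
elim: r r' => [|i r IH] [|i' r'] // pr pr' pw pw' eqF.
- by case: (Qdes0 i' r'); [case/andP: pr' | rewrite -eqF].
- by case: (Qdes0 i r); [case/andP: pr |].
have [i0 r0] := andP pr; have [i0' r0'] := andP pr'.
have [in_i del_i] : i \in Qdes (revF (i :: r)) /\ delF (revF (i :: r)) i = revF r.
  exact: delF_mulF.
have [in_i' del_i'] :
    i' \in Qdes (revF (i' :: r')) /\ delF (revF (i' :: r')) i' = revF r'.
  exact: delF_mulF.
have def_i : i = i'.
  apply/eqP; rewrite eqn_leq (Qdes_revF pr' pw') -?eqF //.
  by rewrite (Qdes_revF pr pw) // eqF.
congr cons => //; apply: IH => //; try by move: pw pw' => /= /andP[] // _ ? /andP[].
by rewrite -[LHS]del_i -[RHS]del_i' eqF def_i.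
Qed.

Fixpoint words n d : seq (seq nat) :=
  if d is d'.+1 then [::] :: [seq i :: r | i <- iota 1 n, r <- words n d']
  else [:: [::]].

Lemma mem_words n d r :
  posw r -> (size r <= d)%N -> all (geq n) r -> r \in words n d.
Proof.
elim: r d => [|i r IH] [|d] //= /andP[i0 r0] szr /andP[lei ler].
rewrite inE /=; apply/allpairsP; exists (i, r); split=> //; last exact: IH.
by rewrite /= mem_iota i0 add1n ltnS.
Qed.

(** * Operators on polynomials *)

Section AbstractPolynomials.

(* The ring Z[t][x] enters only through its variables, its substitutions, its
   generation by the variables, and the regularity of the x_i - t_k. *)
Variables (R : comNzRingType) (X T : nat -> R).
Variable sub : (nat -> R) -> (nat -> R) -> R -> R.

Hypothesis subD : forall sx st f g, sub sx st (f + g) = sub sx st f + sub sx st g.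
Hypothesis subM : forall sx st f g, sub sx st (f * g) = sub sx st f * sub sx st g.
Hypothesis sub_int : forall sx st (c : int), sub sx st c%:~R = c%:~R.
Hypothesis sub_x : forall sx st j, (0 < j)%N -> sub sx st (X j) = sx j.
Hypothesis sub_t : forall sx st j, (0 < j)%N -> sub sx st (T j) = st j.
Hypothesis poly_ind : forall Q : R -> Prop,
    (forall c : int, Q c%:~R) -> (forall f g, Q f -> Q g -> Q (f + g)) ->
    (forall j f, (0 < j)%N -> Q f -> Q (X j * f)) ->
    (forall j f, (0 < j)%N -> Q f -> Q (T j * f)) ->
  forall f, Q f.
Hypothesis xt_mulI : forall i k, injective (fun g : R => (X i - T k) * g).

Lemma subN sx st f : sub sx st (- f) = - sub sx st f.
Proof. by rewrite -mulN1r subM -[-1]/((-1)%:~R) sub_int mulN1r. Qed.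

Lemma subB sx st f g : sub sx st (f - g) = sub sx st f - sub sx st g.
Proof. by rewrite subD subN. Qed.

Lemma eq_sub sx sx' st st' f :
    (forall j, (0 < j)%N -> sx j = sx' j) ->
    (forall j, (0 < j)%N -> st j = st' j) ->
  sub sx st f = sub sx' st' f.
Proof.
move=> eqx eqt; elim/poly_ind: f => [c|f g IHf IHg|j f j0 IH|j f j0 IH].
- by rewrite !sub_int.
- by rewrite !subD IHf IHg.
- by rewrite !subM IH !sub_x // eqx.
- by rewrite !subM IH !sub_t // eqt.
Qed.

Lemma sub_comp sx st sx' st' f :
  sub sx st (sub sx' st' f) =
  sub (fun j => sub sx st (sx' j)) (fun j => sub sx st (st' j)) f.
Proof.
elim/poly_ind: f => [c|f g IHf IHg|j f j0 IH|j f j0 IH].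
- by rewrite !sub_int.
- by rewrite !subD IHf IHg.
- by rewrite !subM IH !sub_x.
- by rewrite !subM IH !sub_t.
Qed.

Lemma sub_id f : sub X T f = f.
Proof.
elim/poly_ind: f => [c|f g IHf IHg|j f j0 IH|j f j0 IH].
- by rewrite !sub_int.
- by rewrite !subD IHf IHg.
- by rewrite !subM IH !sub_x.
- by rewrite !subM IH !sub_t.
Qed.

(** [ins_before i k] and [ins_after i k] are the images of the x-variables under R^-_{i,A} and
    R^+_{i,A} when \overline{A}_i = k. *)
Definition ins_before i k j : R :=
  if (j < i)%N then X j else if j == i then T k else X j.-1.

Definition ins_after i k j : R :=
  if (j <= i)%N then X j else if j == i.+1 then T k else X j.-1.

Definition quot_spec i k f g : Prop :=
  (X i - T k) * g = sub (ins_after i k) T f - sub (ins_before i k) T f.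

(* [quot i k] is E_{i,A} for any A with \overline{A}_i = k. *)
Definition quot i k f : R := epsilon (inhabits 0) (quot_spec i k f).

Lemma quot_unique i k f g h : quot_spec i k f g -> quot_spec i k f h -> g = h.
Proof.
rewrite /quot_spec => eq_g eq_h.
by apply: (xt_mulI (i := i) (k := k)); rewrite eq_g.
Qed.

(** Certifies that the only x-variables in the polynomial are x_1, ..., x_n and that its x-degree is
    at most [d]. Quotients are constructed by induction on this certificate. *)
Inductive bounded (n : nat) : nat -> R -> Prop :=
| BoundedInt d (c : int) : bounded n d c%:~R
| BoundedAdd d f g : bounded n d f -> bounded n d g -> bounded n d (f + g)
| BoundedX d j f : (0 < j <= n)%N -> bounded n d f -> bounded n d.+1 (X j * f)
| BoundedT d j f : (0 < j)%N -> bounded n d f -> bounded n d (T j * f).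

Lemma boundedW n n' d d' f :
  (n <= n')%N -> (d <= d')%N -> bounded n d f -> bounded n' d' f.
Proof.
move=> le_n le_d bf; elim: bf d' le_d => {d f}.
- by move=> *; apply: BoundedInt.
- by move=> d f g _ IHf _ IHg d' le_d; apply: BoundedAdd; auto.
- move=> d j f /andP[j0 lej] _ IH [//|d'] le_d; apply: BoundedX; last by auto.
  by rewrite j0 (leq_trans lej).
- by move=> d j f j0 _ IH d' le_d; apply: BoundedT; auto.
Qed.

Lemma bounded_exists f : exists n d, bounded n d f.
Proof.
elim/poly_ind: f => [c|f g|j f j0|j f j0].
- by exists 0%N, 0%N; apply: BoundedInt.
- move=> [n [d bf]] [n' [d' bg]]; exists (maxn n n'), (maxn d d').
  by apply: BoundedAdd; [apply: boundedW bf | apply: boundedW bg];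
    rewrite ?leq_maxl ?leq_maxr.
- move=> [n [d bf]]; exists (maxn n j), d.+1; apply: BoundedX.
    by rewrite j0 leq_maxr.
  by apply: boundedW bf; rewrite ?leq_maxl.
- by move=> [n [d bf]]; exists n, d; apply: BoundedT.
Qed.

Lemma bounded_opp n d f : bounded n d f -> bounded n d (- f).
Proof.
elim=> {d f} [d c|d f g _ IHf _ IHg|d j f lej _ IH|d j f j0 _ IH].
- by rewrite -rmorphN; apply: BoundedInt.
- by rewrite opprD; apply: BoundedAdd.
- by rewrite -mulrN; apply: BoundedX.
- by rewrite -mulrN; apply: BoundedT.
Qed.

Lemma bounded_sub n d f (sx : nat -> R) :
    (forall j, (0 < j <= n)%N ->
       (exists2 k, (0 < k)%N & sx j = T k) \/
       (exists2 k, (0 < k <= n)%N & sx j = X k)) ->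
  bounded n d f -> bounded n d (sub sx T f).
Proof.
move=> Hsx; elim=> {d f} [d c|d f g _ IHf _ IHg|d j f lej _ IH|d j f j0 _ IH].
- by rewrite sub_int; apply: BoundedInt.
- by rewrite subD; apply: BoundedAdd.
- have j0 : (0 < j)%N by case/andP: lej.
  rewrite subM sub_x //; case: (Hsx j lej) => [][k Hk ->].
    by apply: BoundedT => //; apply: boundedW IH.
  exact: BoundedX.
- by rewrite subM sub_t //; apply: BoundedT.
Qed.

Lemma bounded_ins_after n i k d f :
  (0 < k)%N -> bounded n d f -> bounded n d (sub (ins_after i k) T f).
Proof.
move=> k0; apply: bounded_sub => j /andP[j0 lej]; rewrite /ins_after.
case: leqP => [leji|ltij]; first by right; exists j; rewrite ?j0.
by case: eqP => [_|neq]; [left; exists k | right; exists j.-1 => //; lia].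
Qed.

(** Twisted Leibniz rule E_i(x_j f) = E_i(x_j) R^+ f + R^-(x_j) E_i f, where E_i(x_j) is 1 for j =
    i, -1 for j = i + 1 and 0 otherwise. *)
Lemma quot_spec_xM i k j f h : (0 < i)%N -> (0 < j)%N -> quot_spec i k f h ->
  quot_spec i k (X j * f)
    (((j == i)%:~R - (j == i.+1)%:~R) * sub (ins_after i k) T f
      + ins_before i k j * h).
Proof.
rewrite /quot_spec => i0 j0 def_h.
rewrite mulrDr [_ * (ins_before _ _ _ * h)]mulrCA def_h.
rewrite !subM !sub_x // /ins_before /ins_after.
case: ltngtP => [ltji|ltij|->].
- by rewrite (ltn_eqF (leqW ltji)) /=; ring.
- by have [->|neq] := eqVneq j i.+1; rewrite ?ltnn /=; ring.
- by rewrite (ltn_eqF (ltnSn i)) /=; ring.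
Qed.

(** The quotient is built along the certificate by the Leibniz rule. At [d = 0] the bound [d.-1]
    does not express a drop in degree, so the last clause records that the quotient vanishes. *)
Lemma quot_bounded_exists n i k d f : (0 < i)%N -> (0 < k)%N -> bounded n d f ->
  exists h, [/\ quot_spec i k f h, bounded n d.-1 h & d = 0%N -> h = 0].
Proof.
move=> i0 k0.
elim=> {d f} [d c|d f g _ [h [dh bh h0]] _ [h' [dh' bh' h0']]
  |d j f lej bf [h [dh bh h0]]|d j f j0 bf [h [dh bh h0]]].
- exists 0; split=> //; first by rewrite /quot_spec !sub_int mulr0 subrr.
  exact: (BoundedInt n d.-1 0).
- exists (h + h'); split; last by move=> d0; rewrite h0 ?h0' ?addr0.
    by rewrite /quot_spec mulrDr dh dh' !subD; ring.
  exact: BoundedAdd.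
- have [j0 lejn] := andP lej.
  eexists; split; [exact: (quot_spec_xM i0 j0 dh) | | by []].
  have bR := bounded_ins_after i k0 bf.
  apply: BoundedAdd.
    case: (j == i); case: (j == i.+1);
      rewrite /= ?subrr ?subr0 ?sub0r ?mul1r ?mul0r ?mulN1r //.
    + exact: (BoundedInt n d 0).
    + exact: bounded_opp.
    + exact: (BoundedInt n d 0).
  (* The factor [ins_before i k j] may raise the x-degree by one: for [d > 0] the bound [d.-1] on
     [h] leaves room, and for [d = 0] the product is zero. *)
  have [d0|dpos] := posnP d.
    by rewrite h0 // mulr0; apply: (BoundedInt n d 0).
  rewrite /ins_before; case: (ltngtP j i) => ltij.
  + by rewrite -(prednK dpos); apply: BoundedX.
  + by rewrite -(prednK dpos); apply: BoundedX => //; lia.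
  + by apply: BoundedT => //; apply: boundedW bh; lia.
- exists (T j * h); split; last by move=> d0; rewrite h0 ?mulr0.
    by rewrite /quot_spec mulrCA dh !subM !sub_t //; ring.
  exact: BoundedT.
Qed.

Lemma quotP i k f : (0 < i)%N -> (0 < k)%N -> quot_spec i k f (quot i k f).
Proof.
move=> i0 k0; have [n [d bf]] := bounded_exists f.
have [h [dh _ _]] := quot_bounded_exists i0 k0 bf.
exact: (epsilon_spec _ (quot_spec i k f) (ex_intro _ h dh)).
Qed.

Lemma quot_eq i k f h : (0 < i)%N -> (0 < k)%N -> quot_spec i k f h ->
  quot i k f = h.
Proof. by move=> i0 k0; apply: quot_unique; apply: quotP. Qed.

Lemma bounded_quot n i k d f : (0 < i)%N -> (0 < k)%N -> bounded n d f ->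
  bounded n d.-1 (quot i k f) /\ (d = 0%N -> quot i k f = 0).
Proof.
move=> i0 k0 bf; have [h [dh bh h0]] := quot_bounded_exists i0 k0 bf.
by rewrite (quot_eq i0 k0 dh).
Qed.

(** Independence of x_j for j > n, expressed through substitutions; [xindep 0] singles out the
    scalars of Z[t]. *)
Definition xindep n f := forall sx sx' : nat -> R,
  (forall j, (0 < j <= n)%N -> sx j = sx' j) -> sub sx T f = sub sx' T f.

Lemma bounded_xindep n d f : bounded n d f -> xindep n f.
Proof.
move=> bf sx sx' eqs.
elim: bf => {d f} [d c|d f g _ IHf _ IHg|d j f lej _ IH|d j f j0 _ IH].
- by rewrite !sub_int.
- by rewrite !subD IHf IHg.
- by have [j0 _] := andP lej; rewrite !subM IH !sub_x // eqs.
- by rewrite !subM IH !sub_t.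
Qed.

Lemma bounded0_xindep n f : bounded n 0 f -> xindep 0 f.
Proof.
move=> bf sx sx' _; move: {-1}0%N (erefl 0%N) bf => d d0 bf.
elim: bf d0 => {d f} [d c|d f g _ IHf _ IHg|//|d j f j0 _ IH] d0.
- by rewrite !sub_int.
- by rewrite !subD IHf ?IHg.
- by rewrite !subM IH ?sub_t.
Qed.

Lemma quot_large n i k f : xindep n f -> (n < i)%N -> (0 < k)%N -> quot i k f = 0.
Proof.
move=> indf ltni k0; apply: quot_eq; rewrite ?(leq_ltn_trans _ ltni) //.
rewrite /quot_spec mulr0 (indf (ins_after i k) (ins_before i k)) ?subrr //.
move=> j /andP[_ lej]; have lt_ji := leq_ltn_trans lej ltni.
by rewrite /ins_after /ins_before lt_ji (ltnW lt_ji).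
Qed.

(** Vanishing of the quotient means R^+ f = R^- f. As [f] involves only x_1, ..., x_i, the left side
    is [f], while on the right t_k has replaced x_i. *)
Lemma quot_eq0_xindep i k f : (0 < i)%N -> (0 < k)%N ->
  xindep i f -> quot i k f = 0 -> xindep i.-1 f.
Proof.
move=> i0 k0 indf q0; have := quotP f i0 k0.
rewrite /quot_spec q0 mulr0 => /esym/eqP; rewrite subr_eq0 => /eqP eqR.
have def_f : f = sub (ins_before i k) T f.
  rewrite -eqR -[LHS]sub_id; apply: indf => j /andP[_ lej].
  by rewrite /ins_after lej.
move=> sx sx' eqs; rewrite def_f !sub_comp.
have eqt (s : nat -> R) g :
    sub (fun j => sub s T (ins_before i k j)) (fun j => sub s T (T j)) g =
    sub (fun j => sub s T (ins_before i k j)) T g.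
  by apply: eq_sub => // j j0; rewrite sub_t.
rewrite !eqt; apply: indf => j /andP[j0 lej]; rewrite /ins_before.
have [->|neq] := eqVneq j i; first by rewrite ltnn !sub_t.
have ltji : (j < i)%N by rewrite ltn_neqAle neq.
by rewrite ltji !sub_x // eqs // j0; lia.
Qed.

Lemma quotD i k f g : (0 < i)%N -> (0 < k)%N ->
  quot i k (f + g) = quot i k f + quot i k g.
Proof.
move=> i0 k0; apply: quot_eq => //; rewrite /quot_spec mulrDr !quotP // !subD.
ring.
Qed.

Lemma quotM i k a f : (0 < i)%N -> (0 < k)%N -> xindep 0 a ->
  quot i k (a * f) = a * quot i k f.
Proof.
move=> i0 k0 inda; apply: quot_eq => //; rewrite /quot_spec mulrCA quotP //.
rewrite !subM !(inda _ X) ?sub_id ?mulrBr //; by case.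
Qed.

(** * Renaming of the t-variables and coefficient functionals *)

Definition map_t (s : nat -> nat) : R -> R := sub X (fun j => T (s j)).

(** Renaming commutes with both insertions once t_k becomes t_{s(k)}, so the renamed quotient solves
    the renamed defining equation; uniqueness concludes. *)
Lemma quot_map_t i k s f :
    (0 < i)%N -> (0 < k)%N -> (forall j, 0 < j -> 0 < s j)%N ->
  quot i (s k) (map_t s f) = map_t s (quot i k f).
Proof.
move=> i0 k0 s_pos; apply: quot_eq; rewrite ?s_pos //.
have eqR (r : nat -> nat -> nat -> R) :
    (forall j, (0 < j)%N -> r i (s k) j = map_t s (r i k j)) ->
    sub (r i (s k)) T (map_t s f) = map_t s (sub (r i k) T f).
  move=> Hr; rewrite /map_t !sub_comp; apply: eq_sub => j j0.
    by rewrite sub_x // Hr.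
  by rewrite !sub_t ?s_pos.
rewrite /quot_spec !eqR.
- rewrite -subB -quotP // /map_t subM subB sub_x // sub_t //.
- move=> j j0; rewrite /ins_before /map_t; case: ltngtP => ltij;
  by rewrite ?sub_t ?sub_x //; lia.
- move=> j j0; rewrite /ins_after /map_t; case: leqP => ltij; first by rewrite sub_x.
  by case: eqP => neq; rewrite ?sub_t ?sub_x //; lia.
Qed.

Definition positive_map (s : nat -> nat) := forall j, (0 < j -> 0 < s j)%N.

Lemma positive_skip s i : positive_map s -> positive_map (s \o skip i).
Proof. by move=> s_pos j j0; apply: s_pos; rewrite /skip; case: ifP. Qed.

(* Words are read from their last letter: the coefficient attached to
   i_1 ... i_k is [rcoef id [:: i_k; ...; i_1]]; the map s enumerates the
   indices of the t-variables which are still available. *)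
Fixpoint rcoef (s : nat -> nat) (r : seq nat) (f : R) : R :=
  if r is i :: r' then rcoef (s \o skip i) r' (quot i (s i) f)
  else sub (T \o s) T f.

Lemma eq_rcoef s s' r f : (forall j, (0 < j)%N -> s j = s' j) -> posw r ->
  rcoef s r f = rcoef s' r f.
Proof.
elim: r s s' f => [|i r IH] s s' f eqs /=.
  by move=> _; apply: eq_sub => // j j0; rewrite /= eqs.
case/andP=> i0 r0; rewrite (eqs i i0); apply: IH => // j j0 /=.
by apply: eqs; rewrite /skip; case: ifP.
Qed.

Lemma rcoefD s r f g : positive_map s -> posw r ->
  rcoef s r (f + g) = rcoef s r f + rcoef s r g.
Proof.
elim: r s f g => [|i r IH] s f g s_pos /=; first by rewrite subD.
case/andP=> i0 r0; rewrite quotD ?s_pos // IH //; exact: positive_skip.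
Qed.

Lemma rcoefM s r a f : positive_map s -> posw r -> xindep 0 a ->
  rcoef s r (a * f) = a * rcoef s r f.
Proof.
move=> s_pos r0 inda; elim: r s f s_pos r0 => [|i r IH] s f s_pos /=.
  by rewrite subM (inda _ X) ?sub_id //; case.
by case/andP=> i0 r0; rewrite quotM ?s_pos // IH //; apply: positive_skip.
Qed.

Lemma xindep_int n (c : int) : xindep n c%:~R.
Proof. by move=> sx sx' _; rewrite !sub_int. Qed.

Lemma rcoef0 s r : positive_map s -> posw r -> rcoef s r 0 = 0.
Proof.
move=> s_pos r0; rewrite -[X in rcoef _ _ X](mul0r 0) rcoefM ?mul0r //.
exact: (@xindep_int 0 0).
Qed.

Lemma rcoefN s r f : positive_map s -> posw r -> rcoef s r (- f) = - rcoef s r f.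
Proof.
move=> s_pos r0; rewrite -mulN1r rcoefM ?mulN1r //.
by rewrite -[-1]/((-1)%:~R); apply: xindep_int.
Qed.

Lemma rcoef_sum s r (I : Type) (l : seq I) (a p : I -> R) :
    positive_map s -> posw r -> (forall i, xindep 0 (a i)) ->
  rcoef s r (\sum_(i <- l) a i * p i) = \sum_(i <- l) a i * rcoef s r (p i).
Proof.
move=> s_pos r0 inda; elim: l => [|i l IH]; first by rewrite !big_nil rcoef0.
by rewrite !big_cons rcoefD // rcoefM // IH.
Qed.

Lemma rcoef_xindep s r f : positive_map s -> posw r -> xindep 0 (rcoef s r f).
Proof.
elim: r s f => [|i r IH] s f s_pos /=; last first.
  by case/andP=> _; apply: IH; apply: positive_skip.
move=> _ sx sx' _; rewrite !sub_comp.
by apply: eq_sub => j j0 /=; rewrite !sub_t ?s_pos.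
Qed.

Lemma rcoef_map_t s s' r f : positive_map s -> positive_map s' -> posw r ->
  rcoef (s \o s') r (map_t s f) = map_t s (rcoef s' r f).
Proof.
move=> s_pos; elim: r s' f => [|i r IH] s' f s'_pos /=.
  move=> _; rewrite /map_t !sub_comp; apply: eq_sub => j j0 /=.
    by rewrite sub_x // sub_t ?s'_pos.
  by rewrite !sub_t ?s_pos.
case/andP=> i0 r0; rewrite quot_map_t ?s'_pos // -IH //.
exact: positive_skip.
Qed.

Lemma rcoef_neq0 n d s r f : bounded n d f -> positive_map s -> posw r ->
  rcoef s r f != 0 -> (size r <= d)%N && all (geq n) r.
Proof.
elim: r s d f => [//|i r IH] s d f bf s_pos /= /andP[i0 r0].
have s0 := positive_skip i s_pos.
have [bq q0] := bounded_quot i0 (s_pos i i0) bf.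
have [ltni|lein] := ltnP n i.
  by rewrite (quot_large (bounded_xindep bf) ltni) ?s_pos // rcoef0 ?eqxx.
case: d bf bq q0 => [|d] bf bq q0; first by rewrite q0 // rcoef0 ?eqxx.
by move=> /(IH _ _ _ bq s0 r0); rewrite /= ltnS.
Qed.

(** Reading a letter [i] turns [s] into [s \o skip i], so the induction on [d] has to range over all
    [s]. *)
Lemma rcoef_inj n d s f : bounded n d f -> positive_map s ->
  (forall r, posw r -> rcoef s r f = 0) -> f = 0.
Proof.
move=> bf s_pos rc0; suff indf : xindep 0 f.
  by rewrite -[RHS](rc0 [::] isT) -[LHS]sub_id; apply: indf; case.
elim: d s f bf s_pos rc0 => [|d IH] s f bf s_pos rc0.
  exact: bounded0_xindep bf.
have q0 i : (0 < i)%N -> quot i (s i) f = 0.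
  move=> i0; have [bq _] := bounded_quot i0 (s_pos i i0) bf.
  have rcq r : posw r -> rcoef (s \o skip i) r (quot i (s i) f) = 0.
    by move=> r0; apply: (rc0 (i :: r)); rewrite /= i0.
  have /= indq := IH _ _ bq (positive_skip i s_pos) rcq.
  by rewrite -[RHS](rcq [::] isT) -[LHS]sub_id; apply: indq; case.
(* All E_i f vanish, so the x-variables can be discarded one by one from x_n down. *)
have := bounded_xindep bf; elim: n {IH bf} => [//|n IHn] indn.
apply: IHn; apply: (quot_eq0_xindep (i := n.+1) (k := s n.+1)) => //.
  exact: s_pos.
exact: q0.
Qed.

(** * Commutation relation and sorting of words *)

Ltac ins_cases :=
  rewrite /ins_after /ins_before;
  repeat (case: ifP => ?); try lia;
  rewrite ?sub_t ?sub_x; try lia; try by [];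
  repeat (case: ifP => ?); try lia; try by []; by congr X; lia.

(** After multiplication by (x_k - t_c)(x_i - t_b) both sides are the same alternating sum of four
    double insertions, matched by [AA] to [BB]. The shift from [k.+1] to [k] occurs because an
    insertion at [i < k] moves later places by one. *)
Lemma quot_comm i k b c f : (0 < i < k)%N -> (0 < b)%N -> (0 < c)%N ->
  quot k c (quot i b f) = quot i b (quot k.+1 c f).
Proof.
move=> /andP[i0 ltik] b0 c0; have k0 := leq_ltn_trans (leq0n i) ltik.
have AA : sub (ins_after k c) T (sub (ins_after i b) T f) =
          sub (ins_after i b) T (sub (ins_after k.+1 c) T f).
  by rewrite !sub_comp; apply: eq_sub => j j0; [ins_cases | rewrite !sub_t].
have AB : sub (ins_after k c) T (sub (ins_before i b) T f) =
          sub (ins_before i b) T (sub (ins_after k.+1 c) T f).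
  by rewrite !sub_comp; apply: eq_sub => j j0; [ins_cases | rewrite !sub_t].
have BA : sub (ins_before k c) T (sub (ins_after i b) T f) =
          sub (ins_after i b) T (sub (ins_before k.+1 c) T f).
  by rewrite !sub_comp; apply: eq_sub => j j0; [ins_cases | rewrite !sub_t].
have BB : sub (ins_before k c) T (sub (ins_before i b) T f) =
          sub (ins_before i b) T (sub (ins_before k.+1 c) T f).
  by rewrite !sub_comp; apply: eq_sub => j j0; [ins_cases | rewrite !sub_t].
(* An insertion at [k > i] fixes x_i and one at [i] sends x_{k+1} to x_k, so the defining equation
   of the inner quotient acquires the required linear factor. *)
have lin_k (r : nat -> R) : r i = X i ->
    (X i - T b) * sub r T (quot i b f) =
    sub r T (sub (ins_after i b) T f) - sub r T (sub (ins_before i b) T f).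
  by move=> ri; rewrite -subB -quotP // subM subB sub_x // sub_t // ri.
have lin_i (r : nat -> R) : r k.+1 = X k ->
    (X k - T c) * sub r T (quot k.+1 c f) =
    sub r T (sub (ins_after k.+1 c) T f) - sub r T (sub (ins_before k.+1 c) T f).
  by move=> rk; rewrite -subB -quotP // subM subB sub_x // sub_t // rk.
apply: (xt_mulI (i := k) (k := c)); apply: (xt_mulI (i := i) (k := b)) => /=.
rewrite quotP // [in RHS]mulrCA quotP // !mulrBr !lin_k ?lin_i ?AA ?AB ?BA ?BB.
- ring.
- by ins_cases.
- by ins_cases.
- by ins_cases.
- by ins_cases.
Qed.

(** Both words consume the t-indices [s i] and [s k.+1] and leave the same ones, because
    [skip i \o skip k] and [skip k.+1 \o skip i] agree. *)
Lemma rcoef_swap s i k r f : (0 < i < k)%N -> positive_map s -> posw r ->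
  rcoef s (i :: k :: r) f = rcoef s (k.+1 :: i :: r) f.
Proof.
move=> ltik s_pos r0 /=; have [i0 lt_ik] := andP ltik.
have -> : skip i k = k.+1 by rewrite /skip ltnNge ltnW.
have -> : skip k.+1 i = i by rewrite /skip ltnW.
rewrite quot_comm ?s_pos //; apply: eq_rcoef => // j j0 /=; congr s.
by rewrite /skip; case: (ltnP j k) => ?; case: (ltnP j i) => ?;
  repeat (case: ifP => ?); lia.
Qed.

(* Reversed words are rewritten with i :: k :: r --> k.+1 :: i :: r for i < k,
   the relation of [rcoef_swap], until they are weakly decreasing. *)
Fixpoint insr i r :=
  if r is k :: r' then if (i < k)%N then k.+1 :: insr i r' else i :: r
  else [:: i].

Definition sortr r := foldr insr [::] r.

Lemma posw_insr i r : (0 < i)%N -> posw r -> posw (insr i r).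
Proof.
move=> i0; elim: r => [|k r IH] /=; first by rewrite i0.
by case/andP=> k0 r0; case: ifP => _ /=; rewrite ?i0 ?k0 ?IH.
Qed.

Lemma posw_sortr r : posw r -> posw (sortr r).
Proof. by elim: r => //= i r IH /andP[i0 r0]; rewrite posw_insr ?IH. Qed.

Lemma rcoef_insr s i r f : (0 < i)%N -> positive_map s -> posw r ->
  rcoef s (i :: r) f = rcoef s (insr i r) f.
Proof.
move=> i0; elim: r s f => [//|k r IH] s f s_pos /andP[k0 r0].
rewrite [insr _ _]/=; case: ifP => // ltik.
rewrite rcoef_swap ?i0 // [in RHS]/= -IH //; exact: positive_skip.
Qed.

Lemma rcoef_sortr s r f : positive_map s -> posw r ->
  rcoef s r f = rcoef s (sortr r) f.
Proof.
elim: r s f => [//|i r IH] s f s_pos /andP[i0 r0].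
rewrite [sortr _]/= -rcoef_insr ?posw_sortr // /= IH //; exact: positive_skip.
Qed.

(** An inserted letter stops in front of the first letter not exceeding it; the letters it passes
    all grow by one and keep their order. *)
Lemma pairwise_sortr r : pairwise geq (sortr r).
Proof.
elim: r => //= i r; elim: (sortr r) => //= k l IH /andP[geqk pw].
case: ifP => [ltik|leki] /=; last first.
  rewrite geqk pw leqNgt leki /= andbT.
  by apply: sub_all geqk => j /= lejk; apply: leq_trans lejk _; rewrite leqNgt leki.
rewrite IH // andbT; move: geqk {IH pw}; elim: l => [|j l IHl] /=.
  by rewrite andbT leqW // ltnW.
case/andP=> lejk geqk; case: ifP => _ /=; first by rewrite ltnS lejk IHl.
rewrite (leqW (ltnW ltik)) (leqW lejk) /=.
by apply: sub_all geqk => j' /= /leqW.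
Qed.

(** * Duality and expansion *)

Section Expansion.

Variable P : forest -> R.
Hypothesis P_ev : forall F, sub T T (P F) = (F == emptyF)%:R.
Hypothesis P_quot : forall F i, (0 < i)%N ->
  quot i i (P F) = if i \in Qdes F then map_t (skip i) (P (delF F i)) else 0.

Lemma rcoef_dual r F : posw r -> rcoef id r (P F) = (revF r == F)%:R.
Proof.
elim: r F => [|i r IH] F /=; first by rewrite eq_sym -P_ev.
case/andP=> i0 r0; rewrite P_quot // mulF_elemF_eq //.
have sk_pos : positive_map (skip i) by apply: (@positive_skip id i).
case: ifP => _; last by rewrite rcoef0.
(* The renaming produced by E_i is exactly the index map carried by the remaining letters, so it can
   be pulled out; it then fixes the resulting integer. *)
rewrite (@eq_rcoef _ (skip i \o id)) // rcoef_map_t // IH //.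
by rewrite /map_t -[_%:R]/((_ == _)%:Z%:~R) sub_int.
Qed.

(* Duality spares a direct check of the relation k.i = i.(k+1) on forests. *)
Lemma revF_sortr r : posw r -> revF (sortr r) = revF r.
Proof.
move=> r0; have := rcoef_dual (revF r) (posw_sortr r0).
rewrite -rcoef_sortr // rcoef_dual // eqxx.
by case: eqP => // _ /eqP; rewrite oner_eq0.
Qed.

Lemma rcoef_revF r r' f : posw r -> posw r' -> revF r = revF r' ->
  rcoef id r f = rcoef id r' f.
Proof.
move=> r0 r0' eqF; rewrite rcoef_sortr // [RHS]rcoef_sortr //.
congr rcoef; apply: revF_inj; rewrite ?posw_sortr ?pairwise_sortr //.
by rewrite !revF_sortr.
Qed.

Theorem forest_expansion f : exists (a : forest -> R) (S : seq forest),
  [/\ uniq S,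
      forall F, F \notin S -> a F = 0,
      f = \sum_(F <- S) a F * P F
    & forall F r, posw r -> revF r = F -> a F = rcoef id r f].
Proof.
have [n [d bf]] := bounded_exists f.
(* The coefficient is read off a chosen factorization; the test in [a] guards against a default
   value of [epsilon], and [aE] shows that every factorization gives the same value. *)
pose w F := epsilon (inhabits [::]) (fun r => posw r /\ revF r = F).
pose a F := if posw (w F) && (revF (w F) == F) then rcoef id (w F) f else 0.
have aE F r : posw r -> revF r = F -> a F = rcoef id r f.
  move=> r0 defF.
  have [w0 wF] : posw (w F) /\ revF (w F) = F.
    by apply: (epsilon_spec _ (fun r => posw r /\ revF r = F)); exists r.
  by rewrite /a w0 wF eqxx; apply: rcoef_revF; rewrite ?wF.
(* By [rcoef_neq0], words longer than [d] or with a letter above [n] contribute nothing. Several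
   words may give one forest, hence [undup]. *)
pose S := undup [seq revF r | r <- words n d].
have a0 F : F \notin S -> a F = 0.
  rewrite /a mem_undup => notS; case: ifP => // /andP[w0 /eqP wF].
  apply/eqP; apply: contraR notS => rc_neq0; apply/mapP; exists (w F) => //.
  by have /andP[szw lew] := rcoef_neq0 bf (fun _ => id) w0 rc_neq0; apply: mem_words.
have indep_a F : xindep 0 (a F).
  rewrite /a; case: ifP => [/andP[w0 _]|_]; first exact: rcoef_xindep.
  exact: (@xindep_int 0 0).
exists a, S; split=> //; first exact: undup_uniq.
apply/eqP; rewrite -subr_eq0; apply/eqP.
have [n' [d' bg]] := bounded_exists (f - \sum_(F <- S) a F * P F).
apply: (rcoef_inj bg (s := id)) => // r r0.
rewrite rcoefD // rcoefN // rcoef_sum //.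
under eq_bigr => F _ do rewrite rcoef_dual //.
have [inS|notS] := boolP (revF r \in S).
  rewrite (bigD1_seq _ inS) ?undup_uniq //= eqxx mulr1 big1 ?addr0.
    by rewrite (aE (revF r) r) ?subrr.
  by move=> F neqF; rewrite eq_sym (negPf neqF) mulr0.
rewrite big1_seq ?subr0 => [|F /andP[_ inS]]; first by rewrite -(aE (revF r) r) ?a0.
by case: eqP inS => [<-|_ _]; [rewrite (negPf notS) | rewrite mulr0].
Qed.

End Expansion.

End AbstractPolynomials.

(** * The ring of double polynomials *)

Local Notation "1" := (@mone _) : monom_scope.
Local Notation "x * y" := (mmul x y) : monom_scope.

Section Substitution.
Variables sx st : nat -> dpoly.

Definition monom_img (m : {cmonom var}) : dpoly :=
  \prod_(v <- finsupp m) varimg sx st v ^+ m v.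

Lemma monom_imgEw (d : {fset var}) (m : {cmonom var}) : (finsupp m `<=` d)%fset ->
  monom_img m = \prod_(v <- d) varimg sx st v ^+ m v.
Proof.
move=> le; rewrite /monom_img (big_fset_incl _ le) // => v _ /fsfun_dflt ->.
exact: expr0.
Qed.

Lemma monom_img_mmorphism : mmorphism monom_img.
Proof.
split; last by rewrite /monom_img mdom1 big_seq_fset0.
move=> m1 m2; rewrite (@monom_imgEw (finsupp m1 `|` finsupp m2)%fset) ?mdomD //.
rewrite (monom_imgEw (fsubsetUl (finsupp m1) (finsupp m2))).
rewrite (monom_imgEw (fsubsetUr (finsupp m1) (finsupp m2))) -big_split /=.
by apply: eq_bigr => v _; rewrite cmM exprD.
Qed.

HB.instance Definition _ :=
  isMultiplicative.Build {cmonom var} dpoly monom_img monom_img_mmorphism.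

Lemma subst_additive : additive (subst sx st).
Proof. exact: (@mmap_is_additive _ _ _ intr monom_img). Qed.

Lemma subst_multiplicative : multiplicative (subst sx st).
Proof. exact: (@mmap_is_multiplicative _ _ _ intr monom_img). Qed.

HB.instance Definition _ :=
  GRing.isAdditive.Build dpoly dpoly (subst sx st) subst_additive.
HB.instance Definition _ :=
  GRing.isMultiplicative.Build dpoly dpoly (subst sx st) subst_multiplicative.
End Substitution.

Lemma substD sx st f g : subst sx st (f + g) = subst sx st f + subst sx st g.
Proof. exact: (raddfD (subst sx st)). Qed.

Lemma substM sx st f g : subst sx st (f * g) = subst sx st f * subst sx st g.
Proof. exact: (rmorphM (subst sx st)). Qed.

Lemma subst_int sx st (c : int) : subst sx st c%:~R = c%:~R.
Proof. exact: (rmorph_int (subst sx st)). Qed.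

Lemma subst_var sx st v : subst sx st << ucm v >> = varimg sx st v.
Proof.
rewrite /subst (@mmapU _ _ _ intr (monom_img sx st)) mul1r /monom_img mdomU.
by rewrite big_seq_fset1 cmUU expr1.
Qed.

Lemma subst_x sx st j : (0 < j)%N -> subst sx st (xv j) = sx j.
Proof. by case: j => // j _; rewrite subst_var. Qed.

Lemma subst_t sx st j : (0 < j)%N -> subst sx st (tv j) = st j.
Proof. by case: j => // j _; rewrite subst_var. Qed.

(** * Generation by the variables and regularity of x_i - t_k *)

Lemma malgU_intmul (c : int) (m : {cmonom var}) :
  (<< c *g m >> : dpoly) = c%:~R * << m >>.
Proof.
rewrite mulrzl; transitivity (mkmalgU m ((1 : int) *~ c)); first by rewrite intz.
exact: (raddfMz (mkmalgU m)).
Qed.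

Lemma malgU_mul (m m' : {cmonom var}) :
  (<< (m * m')%M >> : dpoly) = << m >> * << m' >>.
Proof. by rewrite malgM_def fgmulUU mulr1. Qed.

Lemma cmonom_factor (m : {cmonom var}) :
  m = 1%M \/ exists v (m' : {cmonom var}),
    m = (ucm v * m')%M /\ mdeg m = (mdeg m').+1.
Proof.
have [->|/eqP m_neq1] := eqVneq m 1%M; [by left | right].
have /fset0Pn [v v_in] : finsupp m != fset0.
  apply: contra_notN m_neq1 => /eqP m0; apply/eqP; rewrite -mdeg_eq0 mdegE m0.
  by rewrite big_seq_fset0.
have v_pos : (0 < m v)%N by rewrite lt0n cmE_neq0.
have def_m : m = (ucm v * divcm m (ucm v))%M.
  apply/eqP/cmP => w; rewrite cmM divcmE cmU.
  by have [<-|] := eqVneq v w; rewrite ?subnKC ?add0n ?subn0.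
by exists v, (divcm m (ucm v)); split=> //; rewrite {1}def_m mdegM mdegU.
Qed.

Lemma dpoly_ind (Q : dpoly -> Prop) :
    (forall c : int, Q c%:~R) -> (forall f g, Q f -> Q g -> Q (f + g)) ->
    (forall j f, (0 < j)%N -> Q f -> Q (xv j * f)) ->
    (forall j f, (0 < j)%N -> Q f -> Q (tv j * f)) ->
  forall f, Q f.
Proof.
move=> Qc QD Qx Qt f; rewrite (monalgE f); elim/big_ind: _ => //; first exact: (Qc 0).
move=> m _; move: (f@_m) => c; have [n le_n] := ubnP (mdeg m).
elim: n m le_n => // n IHn m le_n.
have [->|[v [m' [def_m def_d]]]] := cmonom_factor m.
  by rewrite malgU_intmul mulr1.
have Qm : Q << c *g m' >> by apply: IHn; rewrite -ltnS -def_d.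
rewrite def_m malgU_intmul malgU_mul mulrCA -malgU_intmul.
by case: v {def_m} => j; [apply: (Qx j.+1) | apply: (Qt j.+1)].
Qed.

Lemma mcoeff_var_mul v (g : dpoly) (m : {cmonom var}) :
  (<< ucm v >> * g)@_m = if m v is 0 then 0 else g@_(divcm m (ucm v)).
Proof.
rewrite malgM_def fgmulUg raddf_sum /=.
under eq_bigr => k _ do rewrite mul1r mcoeffU.
case def_mv: (m v) => [|n].
  rewrite big1_seq // => k _; case: eqP => // def_m.
  by move: def_mv; rewrite -def_m cmM cmUU.
have div_eq k : ((ucm v * k)%M == m) = (k == divcm m (ucm v)).
  apply/eqP/eqP => [<-|->]; apply/eqP/cmP => w.
    by rewrite divcmE cmM addKn.
  rewrite cmM divcmE cmU; have [<-|] := eqVneq v w; last by rewrite subn0.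
  by rewrite def_mv subnKC.
under eq_bigr => k _ do rewrite div_eq.
have [inn|out] := boolP (divcm m (ucm v) \in msupp g); last first.
  rewrite mcoeff_outdom // big1_seq // => k /andP[_ k_in]; case: eqP => // def_k.
  by rewrite -def_k in out; rewrite k_in in out.
rewrite (big_fsetD1 _ inn) /= eqxx mulr1n big1_seq ?addr0 // => k.
by rewrite !inE => /andP[_ /andP[/negPf -> _]].
Qed.

(** Comparing coefficients at x_i m in x_i g = t_k g equates the coefficient of [g] at m with the
    one at x_i m / t_k, or with 0 if t_k does not divide m. The exponent of t_k drops, so the
    descent ends at 0. *)
Lemma xt_mul_eq0 i k (g : dpoly) : (xv i - tv k) * g = 0 -> g = 0.
Proof.
rewrite mulrBl => /eqP; rewrite subr_eq0 => /eqP eq_xt.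
apply/malgP => m; rewrite mcoeff0.
have eqM M : (xv i * g)@_M = (tv k * g)@_M := congr1 (mcoeff M) eq_xt.
have [n] := ubnP (m (inr k.-1)); elim: n m {eq_xt} => [m|n IHn m le_n].
  by rewrite ltn0.
pose M : {cmonom var} := (ucm (inl i.-1 : var) * m)%M.
have def_m : divcm M (ucm (inl i.-1 : var)) = m.
  by apply/eqP/cmP => w; rewrite divcmE cmM addKn.
have Mx : M (inl i.-1) = (m (inl i.-1)).+1 by rewrite cmM cmUU.
have Mt : M (inr k.-1) = m (inr k.-1) by rewrite cmM cmU.
have Ex := mcoeff_var_mul (inl i.-1) g M; rewrite Mx def_m in Ex.
have Et := mcoeff_var_mul (inr k.-1) g M; rewrite Mt in Et.
rewrite -Ex; transitivity (tv k * g)@_M; first exact: eqM.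
rewrite Et {Ex Et eqM}.
case def_n: (m _) => [//|p]; apply: IHn.
by rewrite divcmE cmUU Mt def_n subn1 -ltnS -def_n.
Qed.

Lemma xt_mulI i k : injective (fun g : dpoly => (xv i - tv k) * g).
Proof.
move=> g h /= eq_gh; apply/eqP; rewrite -subr_eq0; apply/eqP.
by apply: (@xt_mul_eq0 i k); rewrite mulrBr eq_gh subrr.
Qed.

Local Notation eq_subst :=
  (eq_sub substD substM subst_int subst_x subst_t dpoly_ind).
Local Notation eq_rcoef_dpoly :=
  (eq_rcoef substD substM subst_int subst_x subst_t dpoly_ind).

(** [EA] sees [A] only through [compl_nth A i], so both sides are convertible. *)
Lemma EA_quot i A f : EA i A f = quot xv tv subst i (compl_nth A i) f.
Proof. by []. Qed.

(** The suffix [w] holds the letters already applied. Moving the last letter [i] of [s] into [w]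
    composes the enumeration with [skip i], by [compl_nth_star1], as in the recursion of [rcoef]. *)
Lemma evA_applyE s w f : posw s ->
  evA (starw (s ++ w)) (applyE (s ++ w) f) =
  rcoef xv tv subst (compl_nth (starw w)) (rev s) (applyE w f).
Proof.
elim/last_ind: s w => [//|s i IH] w; rewrite all_rcons => /andP[i0 s0].
rewrite cat_rcons rev_rcons IH //; apply: eq_rcoef_dpoly; rewrite ?all_rev //.
by move=> j j0; apply: compl_nth_star1.
Qed.

Lemma coef_word_rcoef s f : posw s ->
  coef_word s f = rcoef xv tv subst id (rev s) f.
Proof.
move=> s0; rewrite -[s in LHS]cats0 [LHS]evA_applyE //.
by apply: eq_rcoef_dpoly; rewrite ?all_rev //; apply: compl_nth_nil.
Qed.

Lemma evA_nil f : evA [::] f = subst tv tv f.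
Proof.
apply: eq_subst => j j0; last by [].
exact: (congr1 tv (compl_nth_nil j0)).
Qed.

Lemma that_map_t i f : that i f = map_t xv tv subst (skip i) f.
Proof.
apply: eq_subst => j j0; first by [].
by rewrite /skip; case: ifP.
Qed.

Theorem theorem10p10 (P : forest -> dpoly)
  (HP : is_double_forest_family P) (f : dpoly) :
  exists (a : forest -> dpoly) (S : seq forest),
    [/\ uniq S,
        forall F, F \notin S -> a F = 0,
        f = \sum_(F <- S) a F * P F
      & forall (F : forest) (s : seq nat), all (fun i => 0 < i)%N s ->
          wordF s = F -> a F = coef_word s f].
Proof.
have [_ P_ev P_quot] := HP.
have Qev F : subst tv tv (P F) = (F == emptyF)%:R.
  rewrite -evA_nil; exact: P_ev.
have Qquot F i : (0 < i)%N -> quot xv tv subst i i (P F) =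
    if i \in Qdes F then map_t xv tv subst (skip i) (P (delF F i)) else 0.
  move=> i0; have := P_quot F i i0.
  by rewrite EA_quot (compl_nth_nil i0) that_map_t.
have [a [S [uniqS a0 def_f aE]]] := forest_expansion substD substM subst_int
  subst_x subst_t dpoly_ind xt_mulI Qev Qquot f.
exists a, S; split; [exact: uniqS | exact: a0 | exact: def_f |].
move=> F s s0 defF; rewrite coef_word_rcoef; last exact: s0.
by apply: aE; rewrite ?all_rev // -wordF_rev.
Qed.
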